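(* Let $\Sigma_{(v,\theta)}^{-1}=\begin{bmatrix} J_{vv} & J_{v\theta} \\ J_{\theta v} & J_{\theta\theta} \end{bmatrix}$ be the inverse covariance matrix of the nodal voltages (magnitudes $v$ and phase angles $\theta$) in a radial grid $\mathcal G$ under the linear coupled (LC) power flow model with Gaussian nodal injection fluctuations. For distinct non-reference buses $i,j$, if $J_{vv}(i,j)+J_{\theta\theta}(i,j)<0$, then $(ij)$ is an edge of $\mathcal G$.
   Context: Power grid: a finite connected simple undirected graph with $N$ non-reference buses and one reference bus; it is radial if it has no cycles. Each line $(ij)$ has resistance $r_{ij}>0$ and reactance $x_{ij}>0$. Put $g_{ij}=\frac{r_{ij}}{r_{ij}^2+x_{ij}^2}$ and $\beta_{ij}=\frac{x_{ij}}{r_{ij}^2+x_{ij}^2}$. For edge weights $w$, the reduced weighted Laplacian $H_w\in\mathbb R^{N\times N}$ (indexed by non-reference buses) is: $H_w(i,i)=\sum_k w_{ik}$ (sum over all lines at $i$, including a line to the reference bus), $H_w(i,j)=-w_{ij}$ if $(ij)$ is a line between distinct non-reference buses, and $0$ otherwise. LC power flow model: $\begin{bmatrix} v \\ \theta \end{bmatrix}=M^{-1}\begin{bmatrix} p \\ q \end{bmatrix}$ with $M=\begin{bmatrix} H_g & H_\beta \\ H_\beta & -H_g \end{bmatrix}$ (invertible), where $p,q\in\mathbb R^N$ are active and reactive injections and $v,\theta\in\mathbb R^N$ are voltage magnitude deviations and phase angles at non-reference buses. Injections at different buses are independent: $(p,q)\sim\mathcal N(0,\Sigma_{(p,q)})$,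 $\Sigma_{(p,q)}=\begin{bmatrix} \Sigma_{pp} & \Sigma_{pq} \\ \Sigma_{qp} & \Sigma_{qq} \end{bmatrix}$ positive definite, each block diagonal, $\Sigma_{pq}=\Sigma_{qp}$. Then $\Sigma_{(v,\theta)}=M^{-1}\Sigma_{(p,q)}M^{-1}$; the blocks $J_{vv},J_{v\theta},J_{\theta v},J_{\theta\theta}$ of its inverse are $N\times N$. *)

(* Defs.v *)
From HB Require Import structures.
From mathcomp Require Import all_boot all_order all_algebra.
From mathcomp Require Import all_classical all_reals all_analysis.

Set Implicit Arguments.
Unset Strict Implicit.
Unset Printing Implicit Defensive.

Import Order.TTheory GRing.Theory Num.Theory.
Import numFieldNormedType.Exports.

Local Open Scope classical_set_scope.
Local Open Scope ring_scope.

Definition simple_graph (V : finType) (e : rel V) : Prop :=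
  symmetric e /\ irreflexive e.

Definition connected_graph (V : finType) (e : rel V) : Prop :=
  forall a b : V, connect e a b.

(* In a simple graph [:: a; b] is a ucycle as soon as a and b are adjacent,
   hence the bound on the size. *)
Definition acyclic_graph (V : finType) (e : rel V) : Prop :=
  forall c : seq V, (2 < size c)%N -> ~ ucycle e c.

(* None is the reference bus. *)
Definition bus (N : nat) : finType := option 'I_N.

Definition radial_grid (N : nat) (line : rel (bus N)) : Prop :=
  [/\ simple_graph line, connected_graph line & acyclic_graph line].

Definition line_parameter (R : realType) (N : nat) (line : rel (bus N))
    (w : bus N -> bus N -> R) : Prop :=
  forall a b : bus N, line a b -> w a b = w b a /\ 0 < w a b.

Definition conductance (R : realType) (N : nat) (r x : bus N -> bus N -> R)
    (a b : bus N) : R :=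
  r a b / (r a b ^+ 2 + x a b ^+ 2).

Definition susceptance (R : realType) (N : nat) (r x : bus N -> bus N -> R)
    (a b : bus N) : R :=
  x a b / (r a b ^+ 2 + x a b ^+ 2).

Definition reduced_laplacian (R : realType) (N : nat) (line : rel (bus N))
    (w : bus N -> bus N -> R) : 'M[R]_N :=
  \matrix_(i, j)
    if i == j then \sum_(k : bus N | line (Some i) k) w (Some i) k
    else if line (Some i) (Some j) then - w (Some i) (Some j)
    else 0.

Definition lc_matrix (R : realType) (N : nat) (line : rel (bus N))
    (r x : bus N -> bus N -> R) : 'M[R]_(N + N) :=
  let Hg := reduced_laplacian line (conductance r x) in
  let Hb := reduced_laplacian line (susceptance r x) in
  block_mx Hg Hb Hb (- Hg).

Definition posdefmx (R : realType) (n : nat) (S : 'M[R]_n) : Prop :=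
  S^T = S /\ forall u : 'rV[R]_n, u != 0 -> 0 < (u *m S *m u^T) 0 0.

Definition stack (A : Type) (N : nat) (a b : 'I_N -> A) (k : 'I_(N + N)) : A :=
  match fintype.split k with inl i => a i | inr i => b i end.

(* Law N(m, s^2).  The library's normal_prob m 0 is not the Dirac mass at m,
   so the degenerate case is handled separately. *)
Definition gaussian_law (R : realType) (m s : R) (A : set R) : \bar R :=
  if s == 0 then \d_m A else normal_prob m s A.

(* X ~ N(0, S): mean 0, covariance S, and every linear combination of the
   components is a (possibly degenerate) Gaussian variable. *)
Definition centered_gaussian_vector (d : measure_display)
    (T : measurableType d) (R : realType) (P : probability T R) (n : nat)
    (X : 'I_n -> {RV P >-> R}) (S : 'M[R]_n) : Prop :=
  [/\ forall i, expectation P (X i) = 0%:E,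
      forall i j, covariance P (X i) (X j) = (S i j)%:E
    & forall c : 'I_n -> R, exists m s : R, 0 <= s /\
        forall A : set R, measurable A ->
          P ((fun t => \sum_i c i * X i t) @^-1` A) = gaussian_law m s A].

(* Mutual independence of the pairs (X i, Y i); since some of the A i may be
   setT, the product rule holds for every subfamily as well. *)
Definition independent_pairs (d : measure_display)
    (T : measurableType d) (R : realType) (P : probability T R) (n : nat)
    (X Y : 'I_n -> {RV P >-> R}) : Prop :=
  forall A : 'I_n -> set (R * R),
    (forall i, measurable (A i)) ->
    P (\bigcap_(i in [set: 'I_n]) ((fun t => (X i t, Y i t)) @^-1` A i)) =
    (\prod_(i < n) P ((fun t => (X i t, Y i t)) @^-1` A i))%E.

(* fine is harmless here: covariances of square-integrable variables are
   finite. *)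
Definition covmx (d : measure_display) (T : measurableType d) (R : realType)
    (P : probability T R) (n : nat) (X : 'I_n -> {RV P >-> R}) : 'M[R]_n :=
  \matrix_(i, j) fine (covariance P (X i) (X j)).

Definition lc_power_flow (d : measure_display) (T : measurableType d)
    (R : realType) (P : probability T R) (N : nat) (line : rel (bus N))
    (r x : bus N -> bus N -> R) (p q v theta : 'I_N -> {RV P >-> R}) : Prop :=
  forall t : T,
    col_mx (\col_i v i t) (\col_i theta i t) =
    invmx (lc_matrix line r x) *m col_mx (\col_i p i t) (\col_i q i t).

(* Main.v *)
(** Sigma_(p,q)^-1 has diagonal blocks A, B, B, C, so J = M Sigma_(p,q)^-1 M
gives Jvv + Jtt = H_g (A + C) H_g + H_beta (A + C) H_beta: the B terms cancel.
Here A + C is a nonnegative diagonal matrix.  If (ij) is not a line, the terms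
k = i and k = j of sum_k H(i,k) (A + C)(k,k) H(k,j) vanish, and every other term
is a nonnegative multiple of a product of two nonpositive off-diagonal Laplacian
entries, so the entry is nonnegative. *)

Require Import Defs.
From mathcomp Require Import all_boot all_order all_algebra.
From mathcomp Require Import all_classical all_reals all_analysis.
From mathcomp Require Import ring lra.
Import Order.TTheory GRing.Theory Num.Theory.
Local Open Scope ring_scope.

(** * Dirichlet energy of a weighted graph *)

Lemma bigsum_option (V : nmodType) (I : finType) (P : pred (option I))
    (F : option I -> V) :
  \sum_(a | P a) F a =
  (if P None then F None else 0) + \sum_(i | P (Some i)) F (Some i).
Proof.
rewrite big_mkcond (bigD1 None) //=; congr (_ + _).
rewrite (reindex_omap Some id) /= => [|[]//].
by rewrite [RHS]big_mkcond; apply: eq_bigl => k; rewrite eqxx.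
Qed.

(** Summation by parts: each line is counted in both directions, so swapping its endpoints and
    adding the two copies of the sum completes the square [(f a - f b) ^+ 2]. *)
Lemma dirichlet_energy (R : comRingType) (V : finType) (e : rel V)
    (w : V -> V -> R) (f : V -> R) :
  symmetric e -> (forall a b, e a b -> w a b = w b a) ->
  (\sum_a f a * \sum_(b | e a b) w a b * (f a - f b)) *+ 2 =
  \sum_a \sum_(b | e a b) w a b * (f a - f b) ^+ 2.
Proof.
move=> esym wsym; rewrite mulr2n.
have swapE : \sum_a f a * \sum_(b | e a b) w a b * (f a - f b) =
    \sum_a \sum_(b | e a b) f b * (w a b * (f b - f a)).
  under eq_bigr do rewrite mulr_sumr.
  rewrite (exchange_big_dep predT) //=; apply: eq_bigr => a _.
  rewrite (eq_bigl (e a)) => [|b]; last by rewrite esym.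
  by apply: eq_bigr => b eab; rewrite wsym // esym.
rewrite {2}swapE -big_split /=; apply: eq_bigr => a _.
rewrite mulr_sumr -big_split /=; apply: eq_bigr => b _; ring.
Qed.

(** * Reduced Laplacian: symmetry, signs and definiteness *)

Section Laplacian.
Context {R : realType} {N : nat} {line : rel (bus N)} {w : bus N -> bus N -> R}.
Context (line_sym : symmetric line).
Context (wP : line_parameter line w).

Let H := reduced_laplacian line w.

Lemma reduced_laplacian_tr : H^T = H.
Proof.
apply/matrixP => i j; rewrite !mxE eq_sym.
case: eqVneq => [->//|_]; rewrite line_sym.
by case: ifP => // /wP[->].
Qed.

Lemma reduced_laplacian_offdiag_le0 i j : i != j -> H i j <= 0.
Proof.
rewrite mxE => /negPf->; case: ifP => // /wP[_ /ltW].
by rewrite oppr_le0.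
Qed.

Lemma reduced_laplacian_nonline i j :
  i != j -> ~~ line (Some i) (Some j) -> H i j = 0.
Proof. by rewrite mxE => /negPf-> /negPf->. Qed.

(** Grounding the reference bus: with [f None = 0], a line to the reference contributes only through
    the diagonal entry, so deleting its row and column from the full Laplacian loses nothing. *)
Lemma reduced_laplacian_apply (f : bus N -> R) (i : 'I_N) :
  irreflexive line -> f None = 0 ->
  \sum_j H i j * f (Some j) =
  \sum_(b | line (Some i) b) w (Some i) b * (f (Some i) - f b).
Proof.
move=> line_irr f0.
under [RHS]eq_bigr do rewrite mulrBr.
rewrite sumrB -mulr_suml [X in _ - X]bigsum_option f0 mulr0 if_same add0r.
rewrite (bigD1 i) //= mxE eqxx; congr (_ + _).
(* Irreflexivity removes the index [i] on the right, which matches the off-diagonal entries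
   remaining on the left. *)
rewrite -sumrN [RHS]big_mkcond [RHS](bigD1 i) //= line_irr add0r.
apply: eq_bigr => j ji; rewrite mxE eq_sym (negPf ji).
by case: ifP; rewrite ?mul0r ?mulNr.
Qed.

Lemma reduced_laplacian_energy (u : 'rV[R]_N) :
  irreflexive line ->
  (u *m H *m u^T) 0 0 *+ 2 =
  \sum_a \sum_(b | line a b)
    w a b * (oapp (u 0) 0 a - oapp (u 0) 0 b) ^+ 2.
Proof.
move=> line_irr; rewrite -dirichlet_energy => [|//|a b /wP[]//].
congr (_ *+ 2); rewrite bigsum_option /= mul0r add0r.
rewrite -mulmxA mxE; apply: eq_bigr => i _; congr (_ * _).
rewrite -(@reduced_laplacian_apply (oapp (u 0) 0)) // mxE.
by apply: eq_bigr => j _; rewrite !mxE.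
Qed.

Lemma reduced_laplacian_quad_ge0 (u : 'rV[R]_N) :
  irreflexive line -> 0 <= (u *m H *m u^T) 0 0.
Proof.
move=> line_irr; rewrite -(pmulrn_lge0 _ (n := 2)) //.
rewrite reduced_laplacian_energy //; apply: sumr_ge0 => a _.
by apply: sumr_ge0 => b /wP[_ /ltW w0]; rewrite mulr_ge0 ?sqr_ge0.
Qed.

(** Zero energy forces the potential to agree at the two ends of every line, hence along every path;
    connectivity links each bus to the reference, where the potential is 0. *)
Lemma reduced_laplacian_quad_eq0 (u : 'rV[R]_N) :
  irreflexive line -> connected_graph line ->
  (u *m H *m u^T) 0 0 = 0 -> u = 0.
Proof.
move=> line_irr conn u0.
have pos a b : line a b ->
    0 <= w a b * (oapp (u 0) 0 a - oapp (u 0) 0 b) ^+ 2.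
  by move=> /wP[_ /ltW w0]; rewrite mulr_ge0 ?sqr_ge0.
have flat a b : line a b -> oapp (u 0) 0 a = oapp (u 0) 0 b.
  move=> ab; have /eqP := reduced_laplacian_energy u line_irr.
  rewrite u0 mul0rn eq_sym psumr_eq0 => [/allP/(_ a)|c _]; last first.
    by apply: sumr_ge0 => ?; exact: pos.
  rewrite mem_index_enum psumr_eq0 => [/(_ isT)/allP/(_ b)|c]; last exact: pos.
  rewrite mem_index_enum ab => /(_ isT); rewrite mulf_eq0 gt_eqF ?sqrf_eq0.
    by rewrite subr_eq0 => /eqP.
  by have [] := wP _ _ ab.
have along a s : path line a s ->
    oapp (u 0) 0 a = oapp (u 0) 0 (last a s).
  by elim: s a => //= b s IH a /andP[/flat-> /IH].
apply/rowP => i; rewrite mxE.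
by have /connectP[s /along/esym sE iE] := conn None (Some i); rewrite -iE in sE.
Qed.

End Laplacian.

Lemma mulmx_diag_laplacian_ge0 (R : realType) (N : nat) (line : rel (bus N))
    (w : bus N -> bus N -> R) (d : 'rV[R]_N) (i j : 'I_N) :
  symmetric line -> line_parameter line w -> (forall k, 0 <= d 0 k) ->
  i != j -> ~~ line (Some i) (Some j) ->
  0 <= (reduced_laplacian line w *m diag_mx d *m reduced_laplacian line w) i j.
Proof.
move=> sym wP d0 ij nij; rewrite mxE; apply: sumr_ge0 => k _.
rewrite mul_mx_diag mxE.
have [->|ki] := eqVneq k i.
  by rewrite [X in _ * X]reduced_laplacian_nonline // mulr0.
have [->|kj] := eqVneq k j.
  by rewrite [X in X * _ * _]reduced_laplacian_nonline // !mul0r.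
rewrite mulrAC mulr_ge0 // mulr_le0 //;
  by apply: reduced_laplacian_offdiag_le0; rewrite // eq_sym.
Qed.

(** * Symmetry and invertibility of the LC matrix *)

Section LC.
Context {R : realType} {N : nat} {line : rel (bus N)} {r x : bus N -> bus N -> R}.
Context (line_sym : symmetric line).
Context (rP : line_parameter line r) (xP : line_parameter line x).

Lemma conductance_parameter : line_parameter line (conductance r x).
Proof.
move=> a b ab; have [rs r0] := rP _ _ ab; have [xs x0] := xP _ _ ab.
by rewrite /conductance -rs -xs divr_gt0 // addr_gt0 // exprn_gt0.
Qed.

Lemma susceptance_parameter : line_parameter line (susceptance r x).
Proof.
move=> a b ab; have [rs r0] := rP _ _ ab; have [xs x0] := xP _ _ ab.
by rewrite /susceptance -rs -xs divr_gt0 // addr_gt0 // exprn_gt0.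
Qed.

Lemma lc_matrix_tr : (lc_matrix line r x)^T = lc_matrix line r x.
Proof.
rewrite /lc_matrix tr_block_mx linearN /=.
rewrite (reduced_laplacian_tr line_sym conductance_parameter).
by rewrite (reduced_laplacian_tr line_sym susceptance_parameter).
Qed.

(* If (u, s) M = 0 then pairing the first block with u, the second with s and
   subtracting kills H_beta and leaves u Hg u^T + s Hg s^T = 0. *)
Lemma lc_matrix_unit :
  irreflexive line -> connected_graph line ->
  lc_matrix line r x \in unitmx.
Proof.
move=> line_irr conn; have gP := conductance_parameter.
rewrite -row_free_unit; apply: inj_row_free => z.
rewrite -[z]hsubmxK; set u := lsubmx z; set s := rsubmx z.
rewrite /lc_matrix mul_row_block -row_mx0 => /eq_row_mx[].
set Hg := reduced_laplacian _ _; set Hb := reduced_laplacian _ _.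
move=> e1 e2.
have bsym : (s *m Hb *m u^T) 0 0 = (u *m Hb *m s^T) 0 0.
  have -> : s *m Hb *m u^T = (u *m Hb *m s^T)^T.
    rewrite !trmx_mul trmxK mulmxA.
    by rewrite (reduced_laplacian_tr line_sym susceptance_parameter).
  by rewrite mxE.
have := congr1 (fun m : 'rV_N => (m *m u^T) 0 0) e1.
have := congr1 (fun m : 'rV_N => (m *m s^T) 0 0) e2.
rewrite !mulmxDl mulmxN mulNmx !mul0mx [LHS]mxE [X in _ + X]mxE [RHS]mxE => e2'.
rewrite [LHS]mxE [RHS]mxE bsym => e1'.
have u_ge0 := reduced_laplacian_quad_ge0 line_sym gP u line_irr.
have s_ge0 := reduced_laplacian_quad_ge0 line_sym gP s line_irr.
(* Both energies are nonnegative and their sum is zero, so each vanishes, and definiteness of [Hg]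
   gives [u = 0] and [s = 0]. *)
rewrite (reduced_laplacian_quad_eq0 line_sym gP u line_irr conn); last first.
  by rewrite -/Hg in u_ge0 s_ge0 *; lra.
rewrite (reduced_laplacian_quad_eq0 line_sym gP s line_irr conn); last first.
  by rewrite -/Hg in u_ge0 s_ge0 *; lra.
by rewrite row_mx0.
Qed.
End LC.

(** * Positive definite matrices with diagonal blocks *)

Section DiagonalBlocks.
Context {R : realType} {N : nat} {a b c : 'rV[R]_N}.
Let S : 'M[R]_(N + N) :=
  block_mx (diag_mx a) (diag_mx b) (diag_mx b) (diag_mx c).
Context (Spos : posdefmx S).

(** Testing [S] on vectors supported on the two coordinates of bus [k] isolates the 2x2 matrix with
    rows [(a, b)] and [(b, c)] at [k]. *)
Lemma posdef_diag_block_quad k (s t : R) :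
  (s, t) != (0, 0) -> 0 < a 0 k * s ^+ 2 + b 0 k * s * t *+ 2 + c 0 k * t ^+ 2.
Proof.
move=> st; have [_ /(_ (row_mx (s *: delta_mx 0 k) (t *: delta_mx 0 k)))] := Spos.
have -> : row_mx (s *: delta_mx 0 k) (t *: delta_mx 0 k) != 0 :> 'rV[R]_(N + N).
  apply: contraNneq st; rewrite -row_mx0 => /eq_row_mx[].
  move=> /matrixP/(_ 0 k) + /matrixP/(_ 0 k).
  by rewrite !mxE !eqxx !mulr1 => -> ->.
move=> /(_ isT); congr (0 < _).
have mul_delta (v : 'rV[R]_N) z :
    (v *m (z *: delta_mx 0 k : 'rV_N)^T) 0 0 = z * v 0 k.
  by rewrite linearZ /= trmx_delta -scalemxAr -colE !mxE.
rewrite /S mul_row_block tr_row_mx mul_row_col mxE !mul_delta !mul_mx_diag.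
rewrite !mxE !eqxx /= !mulr1; ring.
Qed.

Lemma posdef_diag_block_a_gt0 k : 0 < a 0 k.
Proof.
have := @posdef_diag_block_quad k 1 0; rewrite xpair_eqE oner_eq0.
by move=> /(_ isT); lra.
Qed.

Lemma posdef_diag_block_c_gt0 k : 0 < c 0 k.
Proof.
have := @posdef_diag_block_quad k 0 1; rewrite xpair_eqE oner_eq0 andbF.
by move=> /(_ isT); lra.
Qed.

Lemma posdef_diag_block_det_gt0 k : 0 < a 0 k * c 0 k - b 0 k ^+ 2.
Proof.
have a0 := posdef_diag_block_a_gt0 k.
(* At [(b, - a)] the form equals [a * (a * c - b ^+ 2)], and [a] is positive. *)
have := @posdef_diag_block_quad k (b 0 k) (- a 0 k).
rewrite xpair_eqE oppr_eq0 (gt_eqF a0) andbF => /(_ isT) h.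
by rewrite -(pmulr_rgt0 _ a0); move: h; congr (0 < _); ring.
Qed.

Let det := \row_k (a 0 k * c 0 k - b 0 k ^+ 2).

(** Diagonal blocks decouple the buses, so [S] is inverted by applying the 2x2 adjugate formula at
    each bus; this swaps the roles of [a] and [c]. *)
Lemma posdef_diag_block_inverse :
  S *m block_mx (diag_mx (\row_k (c 0 k / det 0 k)))
                (diag_mx (\row_k (- b 0 k / det 0 k)))
                (diag_mx (\row_k (- b 0 k / det 0 k)))
                (diag_mx (\row_k (a 0 k / det 0 k))) = 1%:M.
Proof.
rewrite /S mulmx_block !mulmx_diag -!linearD /= scalar_mx_block.
rewrite -!diag_const_mx -(linear0 (@diag_mx R N)).
congr block_mx; congr diag_mx; apply/rowP => k; rewrite !mxE; field;
  by rewrite gt_eqF // posdef_diag_block_det_gt0.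
Qed.
End DiagonalBlocks.

(** * Covariance of linear images of square-integrable vectors *)

Section Covariance.
Context {d : measure_display} {T : measurableType d} {R : realType}.
Context {P : probability T R}.

(** For a centered variable the variance is the integral of [X ^+ 2], so a real value for it is
    exactly square integrability. *)
Lemma Lfun2_of_centered (X : {RV P >-> R}) (s : R) :
  expectation P X = 0%:E -> covariance P X X = s%:E ->
  (X : T -> R) \in Lfun P 2%:E.
Proof.
move=> EX0; rewrite covariance.unlock EX0 /= expectation.unlock => covX.
rewrite inE; apply/andP; split; rewrite inE /=; first exact: measurable_funPT.
rewrite /finite_norm unlock poweR_lty //.
under eq_integral => t _.
  rewrite abse_EFin poweR_EFin powR_mulrn // real_normK ?num_real // expr2.
  over.
have sqE : (X \- cst 0) * (X \- cst 0) = (fun t => X t * X t) :> (T -> R).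
  by apply/funext => t; rewrite fctE /= subr0.
by rewrite sqE in covX; rewrite covX ltry.
Qed.

Lemma Lfun2_lincomb (I : Type) (s : seq I) (c : I -> R) (X : I -> T -> R) :
  (forall i, X i \in Lfun P 2%:E) ->
  (fun t => \sum_(i <- s) c i * X i t) \in Lfun P 2%:E.
Proof.
move=> X2; elim: s => [|i s IH].
  rewrite [X in X \in _](_ : _ = cst 0) ?Lfun_cst //.
  by apply/funext => t; rewrite big_nil.
rewrite [X in X \in _](_ : _ =
    (c i \o* X i) + (fun t => \sum_(j <- s) c j * X j t)); last first.
  by apply/funext => t; rewrite big_cons fctE /= mulrC.
apply: (Lfun_addr_closed P (lee1n 2)).2 => //.
by rewrite Lfun_scale // ler1n.
Qed.

Lemma covariance_lincombl (I : Type) (s : seq I) (c : I -> R)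
    (X : I -> T -> R) (Z : T -> R) :
  (forall i, X i \in Lfun P 2%:E) -> Z \in Lfun P 2%:E ->
  fine (covariance P (fun t => \sum_(i <- s) c i * X i t) Z) =
  \sum_(i <- s) c i * fine (covariance P (X i) Z).
Proof.
move=> X2 Z2.
have Pfin : P setT \is a fin_num := fin_num_measure P _ measurableT.
have L1 := Lfun_subset12 Pfin.
(* Covariances live in the extended reals; finiteness is what lets [fine] commute with the sum and
   the scaling below. *)
have cov_fin (U : T -> R) : U \in Lfun P 2%:E -> covariance P U Z \is a fin_num.
  by move=> U2; rewrite covariance_fin_num ?Lfun2_mul_Lfun1 ?L1.
elim: s => [|i s IH].
  rewrite big_nil [X in covariance _ X](_ : _ = cst 0) ?covariance_cst_l //.
  by apply/funext => t; rewrite big_nil.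
rewrite big_cons -IH [X in covariance _ X](_ : _ =
    (c i \o* X i) \+ (fun t => \sum_(j <- s) c j * X j t)); last first.
  by apply/funext => t; rewrite big_cons /= mulrC.
have cX2 : c i \o* X i \in Lfun P 2%:E by rewrite Lfun_scale // ler1n.
have sX2 := Lfun2_lincomb _ s c _ X2.
rewrite covarianceDl // fineD ?cov_fin // covarianceZl ?Lfun2_mul_Lfun1 ?L1 //.
by rewrite fineM // cov_fin.
Qed.

Lemma covmx_linear (m n : nat) (X : 'I_n -> {RV P >-> R})
    (Y : 'I_m -> {RV P >-> R}) (K : 'M[R]_(m, n)) :
  (forall j, (X j : T -> R) \in Lfun P 2%:E) ->
  (forall i t, Y i t = \sum_j K i j * X j t) ->
  covmx Y = K *m covmx X *m K^T.
Proof.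
move=> X2 YE.
have YfE i : (Y i : T -> R) = (fun t => \sum_j K i j * X j t).
  by apply/funext => t; exact: YE.
apply/matrixP => i k; rewrite -mulmxA !mxE YfE covariance_lincombl //; last first.
  by rewrite YfE; exact: Lfun2_lincomb.
(* Symmetry of the covariance moves the second combination to the left argument, so that left
   linearity serves twice. *)
apply: eq_bigr => j _; rewrite !mxE covarianceC YfE covariance_lincombl //.
by congr (_ * _); apply: eq_bigr => l _; rewrite !mxE covarianceC mulrC.
Qed.

End Covariance.

(** Applied with [Q] the inverse of the injection covariance, this yields the inverse covariance of
    the voltages. By symmetry of [M] the outer factors cancel, so [M *m Q *m M] is a right inverse,
    which suffices for square matrices. *)
Lemma invmx_congruence (R : comUnitRingType) (n : nat) (M S Q : 'M[R]_n) :
  M \in unitmx -> M^T = M -> S *m Q = 1%:M ->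
  invmx (invmx M *m S *m (invmx M)^T) = M *m Q *m M.
Proof.
move=> Mu MT SQ.
have h : (invmx M *m S *m (invmx M)^T) *m (M *m Q *m M) = 1%:M.
  rewrite trmx_inv MT !mulmxA mulmxKV // -(mulmxA _ S) SQ mulmx1.
  by rewrite mulVmx.
have [Au _] := mulmx1_unit h.
by rewrite -[RHS](mulKmx Au) h mulmx1.
Qed.

Theorem theorem7 (R : realType) (N : nat)
    (line : rel (bus N)) (hgrid : radial_grid line)
    (r x : bus N -> bus N -> R)
    (hr : line_parameter line r) (hx : line_parameter line x)
    (Spp Spq Sqp Sqq : 'M[R]_N)
    (hdpp : is_diag_mx Spp) (hdpq : is_diag_mx Spq)
    (hdqp : is_diag_mx Sqp) (hdqq : is_diag_mx Sqq)
    (hpq : Spq = Sqp)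
    (hpos : posdefmx (block_mx Spp Spq Sqp Sqq))
    (d : measure_display) (T : measurableType d) (P : probability T R)
    (p q v theta : 'I_N -> {RV P >-> R})
    (hind : independent_pairs p q)
    (hgauss : centered_gaussian_vector (stack p q)
                (block_mx Spp Spq Sqp Sqq))
    (hlc : lc_power_flow line r x p q v theta)
    (Jvv Jvt Jtv Jtt : 'M[R]_N)
    (hJ : invmx (covmx (stack v theta)) = block_mx Jvv Jvt Jtv Jtt)
    (i j : 'I_N) (hij : i != j) :
  Jvv i j + Jtt i j < 0 -> line (Some i) (Some j).
Proof.
apply: contraTT => nij; rewrite -leNgt.
have [[sym irr] conn _] := hgrid.
have gP := conductance_parameter hr hx; have bP := susceptance_parameter hr hx.
move: hpos hgauss; rewrite -hpq.
have /diag_mxP[a ->] := hdpp; have /diag_mxP[b ->] := hdpq.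
have /diag_mxP[c ->] := hdqq => Spos [E0 covS _].
set S := block_mx _ _ _ _ in Spos covS.
have pq2 k : (stack p q k : T -> R) \in Lfun P 2%:E.
  exact: Lfun2_of_centered (E0 k) (covS k k).
have covmxS : covmx (stack p q) = S.
  by apply/matrixP => k l; rewrite mxE covS.
(* The pointwise power flow equation becomes a coordinatewise linear map on stacked vectors, the
   form that [covmx_linear] takes. *)
have vtE k t : stack v theta k t =
    \sum_l invmx (lc_matrix line r x) k l * stack p q l t.
  have stackE (f g : 'I_N -> {RV P >-> R}) m :
      stack f g m t = col_mx (\col_i f i t) (\col_i g i t) m 0.
    by rewrite mxE /stack; case: fintype.split => ?; rewrite mxE.
  by rewrite stackE hlc mxE; under eq_bigr do rewrite -stackE.
move: hJ; rewrite (covmx_linear _ _ _ _ _ pq2 vtE) covmxS.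
rewrite (invmx_congruence _ _ _ _ _ _ (lc_matrix_tr sym hr hx)
  (posdef_diag_block_inverse Spos)) ?lc_matrix_unit //.
rewrite /lc_matrix !mulmx_block => /eq_block_mx[<- _ _ <-].
set Hg := reduced_laplacian _ _; set Hb := reduced_laplacian _ _.
set A := diag_mx _; set B := diag_mx _; set C := diag_mx _.
(* The sign of the lower right block [- Hg] makes the mixed terms [Hg *m B *m Hb] and
   [Hb *m B *m Hg] appear with opposite signs in the two diagonal blocks. *)
have : (Hg *m A + Hb *m B) *m Hg + (Hg *m B + Hb *m C) *m Hb +
    ((Hb *m A + - Hg *m B) *m Hb + (Hb *m B + - Hg *m C) *m - Hg) =
    Hg *m (A + C) *m Hg + Hb *m (A + C) *m Hb.
  rewrite !(mulmxDl, mulmxDr, mulNmx, mulmxN, opprK).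
  (* Once the triple products are opaque, only additive identities remain, and [ring] settles them
     entry by entry. *)
  move: (Hg *m A *m Hg) (Hg *m B *m Hb) (Hg *m C *m Hg) => X1 X2 X3.
  move: (Hb *m A *m Hb) (Hb *m B *m Hg) (Hb *m C *m Hb) => Y1 Y2 Y3.
  apply/matrixP => k l; rewrite !mxE; ring.
move=> /(congr1 (fun m : 'M[R]_N => m i j)); rewrite [LHS]mxE => ->.
rewrite mxE /A /C -linearD /=; set D := (X in diag_mx X).
(* The entry of [D] at [k] is [c / det + a / det], with all three quantities positive. *)
have D_ge0 k : 0 <= D 0 k.
  have := posdef_diag_block_det_gt0 Spos k.
  have := posdef_diag_block_a_gt0 Spos k; have := posdef_diag_block_c_gt0 Spos k.
  by move=> c0 a0 det0; rewrite !mxE addr_ge0 // divr_ge0 // ltW.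
by rewrite addr_ge0 // mulmx_diag_laplacian_ge0.
Qed.
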